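(* Let $p,q$ be natural numbers and let $T=T_v$ with $v=\{(p_n,\ell_n,q_n,m_n):n\in\mathbb N\}\in\mathcal V$. If the set $\{n\in\mathbb N:\ p\,q_n-q\,p_n=0\}$ is infinite and the set $\{n\in\mathbb N:\ 0\neq|p\,q_n-q\,p_n|\le (p+q)h_n\}$ is finite, then $T^p\times T^q$ is conservative and not ergodic.
   Context: Rank-one construction (cutting and stacking): let $a_n,b_n,c_n,d_n$ ($n\ge 0$) be sequences of positive integers. Let $G_0$ be the unit interval $[0,1)$, a column of height $H_0=1$ (set $h_0=1$). Given the column $G_n$ of height $H_n$, form $G_{n+1}$ by cutting $G_n$ into four subcolumns of equal width, placing $a_n,b_n,c_n,d_n$ spacers on top of the first, second, third and fourth subcolumns respectively, and stacking the subcolumns from left to right. This defines a Lebesgue-measure-preserving invertible transformation $T$ on a subset of $\mathbb R$ with Lebesgue measure $\mu$. Put $p_n=H_n+a_n$, $\ell_n=H_n+b_n$, $q_n=H_n+c_n$, $m_n=H_n+d_n$ and $h_{n+1}=p_n+\ell_n+q_n+H_n$. Write $T=T_v$ with $v=\{(p_n,\ell_n,q_n,m_n)\}$. $\mathcal W$ is the set of such $v$ with $\lim p_n/h_n=\infty$, $\ell_n>n(p_n+q_n+2h_n)$ and $m_n>n\,h_{n+1}$ for all $n$; $\mathcal V=\{v\in\mathcal W: p_n\le q_n \text{ for all } n\}$. A measure-preserving $S$ is conservative if for every set $A$ of positive measure there is $n\ge1$ with $\mu(S^{-n}A\cap A)>0$. *)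

(* Defs.v *)
From HB Require Import structures.
From mathcomp Require Import all_boot all_order all_algebra.
From mathcomp Require Import all_classical all_reals all_analysis.
Set Implicit Arguments. Unset Strict Implicit. Unset Printing Implicit Defensive.
Import Order.TTheory GRing.Theory Num.Theory.
Import numFieldNormedType.Exports.
Local Open Scope classical_set_scope.
Local Open Scope ring_scope.

(* Rank-one cutting and stacking construction with four subcolumns.
   Input: spacer sequences a b c d : nat -> nat (required positive in the
   theorem).  Conventions:
   - the column G_n has H n levels, each an interval [x, x + w n) of width
     w n = 4^-n, listed bottom to top by their left endpoints (col n);
   - G_0 = [0,1);
   - the spacers added at stage n are fresh intervals of width w (n+1) taken
     consecutively from [E n, E (n+1)), where [0, E n) is the region already
     used by G_n;
   - T maps each non-top level of some G_n onto the next level by translation,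
     and is the identity elsewhere (a null set inside X, or outside X). *)

Section RankOne.
Variable R : realType.
Variables a b c d : nat -> nat.

Fixpoint H (n : nat) : nat :=
  match n with 0 => 1%N | n'.+1 => (4 * H n' + a n' + b n' + c n' + d n')%N end.

Definition pp (n : nat) : nat := (H n + a n)%N.
Definition ll (n : nat) : nat := (H n + b n)%N.
Definition qq (n : nat) : nat := (H n + c n)%N.
Definition mm (n : nat) : nat := (H n + d n)%N.

Definition hh (n : nat) : nat :=
  match n with 0 => 1%N | n'.+1 => (pp n' + ll n' + qq n' + H n')%N end.

Definition w (n : nat) : R := ((4 ^ n)%:R)^-1.

Fixpoint E (n : nat) : R :=
  match n with
  | 0 => 1
  | n'.+1 => E n' + (a n' + b n' + c n' + d n')%:R * w n'.+1
  end.

Definition spacers (s wd : R) (k : nat) : seq R :=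
  [seq s + i%:R * wd | i <- iota 0 k].

Fixpoint col (n : nat) : seq R :=
  match n with
  | 0 => [:: 0]
  | n'.+1 =>
    let C := col n' in
    let wd := w n'.+1 in
    let s := E n' in
    C ++ spacers s wd (a n')
      ++ [seq x + wd | x <- C] ++ spacers (s + (a n')%:R * wd) wd (b n')
      ++ [seq x + 2 * wd | x <- C]
      ++ spacers (s + (a n' + b n')%:R * wd) wd (c n')
      ++ [seq x + 3 * wd | x <- C]
      ++ spacers (s + (a n' + b n' + c n')%:R * wd) wd (d n')
  end.

Definition in_level (n j : nat) (x : R) : Prop :=
  (j.+1 < size (col n))%N /\
  nth 0 (col n) j <= x < nth 0 (col n) j + w n.

Definition T (x : R) : R :=
  xget x [set y | exists n j, in_level n j x /\
                   y = x + (nth 0 (col n) j.+1 - nth 0 (col n) j)].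

(* the phase space X = union of all columns = [0, sup E) *)
Definition X : set R := [set x | exists n, 0 <= x < E n].

End RankOne.

Definition in_W (R : realType) (a b c d : nat -> nat) : Prop :=
  [/\ (fun n => ((pp a b c d n)%:R / (hh a b c d n)%:R : R)) @ \oo --> +oo,
      (forall n, ll a b c d n > n * (pp a b c d n + qq a b c d n + 2 * hh a b c d n))%N
    & (forall n, mm a b c d n > n * hh a b c d n.+1)%N].

Definition in_V (R : realType) (a b c d : nat -> nat) : Prop :=
  in_W R a b c d /\ (forall n, pp a b c d n <= qq a b c d n)%N.

Section Dyn.
Context (dT : measure_display) (U : measurableType dT) (R : realType).
Variables (mu : set U -> \bar R) (Y : set U) (S : U -> U).

Definition conservative_on : Prop :=
  forall A, measurable A -> A `<=` Y -> (0 < mu A)%E ->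
    exists n, (0 < n)%N /\ (0 < mu (iter n S @^-1` A `&` A))%E.

Definition ergodic_on : Prop :=
  forall A, measurable A -> A `<=` Y -> Y `&` S @^-1` A = A ->
    mu A = 0%E \/ mu (Y `\` A) = 0%E.
End Dyn.

Definition prodmap (R : realType) (a b c d : nat -> nat) (p q : nat)
  (z : R * R) : R * R :=
  (iter p (T a b c d) z.1, iter q (T a b c d) z.2).

(* Main.v *)
Require Import Defs.
From HB Require Import structures.
From mathcomp Require Import all_boot all_order all_algebra.
From mathcomp Require Import all_classical all_reals all_analysis.
From mathcomp Require Import measurable_realfun zify ring lra.
Import Order.TTheory GRing.Theory Num.Theory.
Import numFieldNormedType.Exports.
Local Open Scope classical_set_scope.
Set Implicit Arguments. Unset Strict Implicit. Unset Printing Implicit Defensive.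

(* A point of the column [G_n] is coded by the index of its level; passing to
   [G_(n+1)] adds to this index one of the offsets [0, P, P + L, P + L + Q],
   where [P, L, Q] stand for [p_n, l_n, q_n].

   Conservativity.  If [p Q = q P] at stage [n], then lowering the subcolumns of
   the two coordinates from (second, fourth) to (first, third) shifts the indices
   by [(- P, - Q)], a multiple of [(p, q)] up to a residue mod [p].  Almost every
   pair of points shows the subcolumns (second, fourth) at infinitely many such
   stages, and by pigeonhole some sums of the corresponding [P]'s are divisible
   by [p].  Hence almost every point of [G_N x G_N] is the image of a point of
   [G_N x G_N] under infinitely many iterates; as [G_N x G_N] has finite measure,
   this excludes wandering sets.

   Non-ergodicity.  The number [q i - p j], for a pair of levels [(i, j)] of a
   high column, is invariant under [T^p x T^q].  By the growth conditions, for
   large [n] two pairs of points with the same number at stage [n + 1] have the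
   same number at stage [n].  So the orbits of the rectangles of levels [(0, 0)]
   and [(1, 0)] of one column [G_n] with [n] large are disjoint. *)

(** * Levels of the columns and the action of [T] on them *)

Section Columns.
Variables (R : realType) (a b c d : nat -> nat).
Local Notation H := (H a b c d).
Local Notation P := (pp a b c d).
Local Notation L := (ll a b c d).
Local Notation Q := (qq a b c d).
Local Notation h := (hh a b c d).
Local Notation w := (Defs.w R).
Local Notation E := (E R a b c d).
Local Notation col := (Defs.col R a b c d).
Local Notation T := (@T R a b c d).
Local Notation X := (@X R a b c d).

Definition off (n k : nat) : nat := nth 0%N [:: 0; P n; P n + L n; P n + L n + Q n]%N k.

Lemma H_gt0 n : (0 < H n)%N.
Proof. by elim: n => //= n IH; lia. Qed.

(** The copies of [G_n] inside [G_(n+1)] end at height [h n.+1]; above it there are only the last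
    [d n] spacers. *)
Lemma HS_hh n : H n.+1 = (h n.+1 + d n)%N.
Proof. by rewrite /= /pp /ll /qq; lia. Qed.

Lemma off_add_lt n k i : (k < 4)%N -> (i < H n)%N -> (i + off n k < h n.+1)%N.
Proof.
by case: k => [|[|[|[|//]]]] _ /=; rewrite /off /= /pp /ll /qq; lia.
Qed.

Lemma off_add_ltH n k i : (k < 4)%N -> (i < H n)%N -> (i + off n k + d n < H n.+1)%N.
Proof. by move=> kk ii; rewrite HS_hh ltn_add2r off_add_lt. Qed.

Lemma w_gt0 n : (0 < w n)%R.
Proof. by rewrite invr_gt0 ltr0n expn_gt0. Qed.

Lemma wS n : (w n = 4 * w n.+1)%R.
Proof.
by rewrite /Defs.w expnS natrM invfM mulrA divff ?mul1r // pnatr_eq0.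
Qed.

Lemma E_Hw n : (E n = (H n)%:R * w n)%R.
Proof.
elim: n => [|n IH] /=; first by rewrite /Defs.w expn0 invr1 mulr1.
by rewrite IH wS !natrD; ring.
Qed.

Lemma size_spacers (s wd : R) k : size (spacers s wd k) = k.
Proof. by rewrite size_map size_iota. Qed.

Lemma size_col n : size (col n) = H n.
Proof.
elim: n => //= n IH.
by rewrite !size_cat !size_map !size_iota IH; lia.
Qed.

Lemma nth_spacers (s wd : R) k i : (i < k)%N -> nth 0%R (spacers s wd k) i = (s + i%:R * wd)%R.
Proof. by move=> ik; rewrite (nth_map 0%N) ?size_iota// nth_iota. Qed.

Lemma mem_spacers (s wd : R) k i : (i < k)%N -> (s + i%:R * wd)%R \in spacers s wd k.
Proof. by move=> ik; rewrite -(nth_spacers s wd ik) mem_nth // size_spacers. Qed.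

(** Links indices with positions: the offset number [k] belongs to the [k]-th quarter of a level.
    The proof skips the blocks of the concatenation one by one. *)
Lemma nth_col_child n i k : (i < H n)%N -> (k < 4)%N ->
  nth 0%R (col n.+1) (i + off n k) = (nth 0%R (col n) i + k%:R * w n.+1)%R.
Proof.
move=> iH; have sC := size_col n.
case: k => [|[|[|[|//]]]] _; rewrite /off /= /pp /ll /qq.
- by rewrite addn0 mul0r addr0 nth_cat sC iH.
- rewrite nth_cat sC ltnNge (_ : _ <= _)%N /=; last lia.
  rewrite nth_cat size_spacers ltnNge (_ : _ <= _)%N /=; last lia.
  rewrite (_ : _ - _ - _ = i)%N; last lia.
  by rewrite nth_cat size_map sC iH (nth_map 0%R) ?sC// mul1r.
- rewrite nth_cat sC ltnNge (_ : _ <= _)%N /=; last lia.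
  rewrite nth_cat size_spacers ltnNge (_ : _ <= _)%N /=; last lia.
  rewrite nth_cat size_map sC ltnNge (_ : _ <= _)%N /=; last lia.
  rewrite nth_cat size_spacers ltnNge (_ : _ <= _)%N /=; last lia.
  rewrite (_ : _ - _ - _ - _ - _ = i)%N; last lia.
  by rewrite nth_cat size_map sC iH (nth_map 0%R) ?sC.
- rewrite nth_cat sC ltnNge (_ : _ <= _)%N /=; last lia.
  rewrite nth_cat size_spacers ltnNge (_ : _ <= _)%N /=; last lia.
  rewrite nth_cat size_map sC ltnNge (_ : _ <= _)%N /=; last lia.
  rewrite nth_cat size_spacers ltnNge (_ : _ <= _)%N /=; last lia.
  rewrite nth_cat size_map sC ltnNge (_ : _ <= _)%N /=; last lia.
  rewrite nth_cat size_spacers ltnNge (_ : _ <= _)%N /=; last lia.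
  rewrite (_ : _ - _ - _ - _ - _ - _ - _ = i)%N; last lia.
  by rewrite nth_cat size_map sC iH (nth_map 0%R) ?sC.
Qed.

Lemma mem_col_grid n k : (k < H n)%N -> (k%:R * w n)%R \in col n.
Proof.
elim: n k => [|n IH] k; first by rewrite ltnS leqn0 => /eqP ->; rewrite mul0r inE.
have [k4 _|k4 kH] := ltnP k (4 * H n).
  (* The point starts quarter [k %% 4] of the level that begins at point [k %/ 4] of the coarser
     grid. *)
  have iH : (k %/ 4 < H n)%N by lia.
  have /(nthP 0%R)[i] := IH _ iH; rewrite size_col => {}iH ie.
  have r4 : (k %% 4 < 4)%N by rewrite ltn_mod.
  rewrite {1}(divn_eq k 4) natrD natrM mulrDl -mulrA -wS -ie -nth_col_child//.
  by rewrite mem_nth // size_col (leq_trans _ (off_add_ltH r4 iH))// ltnS leq_addr.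
(* [s] is the position among the spacers of this stage, laid consecutively from [E n] on. *)
set s := (k - 4 * H n)%N.
have sl : (s < a n + b n + c n + d n)%N by move: kH; rewrite /s /=; lia.
have -> : (k%:R * w n.+1 = E n + s%:R * w n.+1)%R.
  rewrite E_Hw (wS n) -(subnK k4) -/s natrD natrM; ring.
rewrite /= !mem_cat.
have [|sa] := ltnP s (a n); first by move=> /mem_spacers ->; rewrite orbT.
have [sb|sb] := ltnP s (a n + b n).
  have : (s - a n < b n)%N by lia.
  move=> /(mem_spacers (E n + (a n)%:R * w n.+1) (w n.+1)).
  by rewrite -addrA -mulrDl -natrD subnKC// => ->; rewrite !orbT.
have [sc|sc] := ltnP s (a n + b n + c n).
  have : (s - (a n + b n) < c n)%N by lia.
  move=> /(mem_spacers (E n + (a n + b n)%:R * w n.+1) (w n.+1)).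
  by rewrite -addrA -mulrDl -natrD subnKC// => ->; rewrite !orbT.
have : (s - (a n + b n + c n) < d n)%N by lia.
move=> /(mem_spacers (E n + (a n + b n + c n)%:R * w n.+1) (w n.+1)).
by rewrite -addrA -mulrDl -natrD subnKC// => ->; rewrite !orbT.
Qed.

(** The [H n] distinct grid points all occur in a list of length [H n], so the list is a permutation
    of them. Hence the levels of [G_n] tile [[0, E n)]. *)
Lemma col_perm n : uniq (col n) /\ [seq (k%:R * w n)%R | k <- iota 0 (H n)] =i col n.
Proof.
set s := map _ _.
have us : uniq s.
  rewrite map_inj_uniq ?iota_uniq// => k l /= kl; apply/eqP.
  by rewrite -(eqr_nat R); apply/eqP/(mulIf (lt0r_neq0 (w_gt0 n))).
have ss : {subset s <= col n}.
  by move=> y /mapP[k]; rewrite mem_iota add0n => /andP[_ kH] ->; exact: mem_col_grid.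
have sz : (size (col n) <= size s)%N by rewrite size_col size_map size_iota.
by split; [exact: leq_size_uniq us ss sz|have [] := uniq_min_size us ss sz].
Qed.

Definition lev n i (x : R) : Prop :=
  (i < H n)%N /\ (nth 0 (col n) i <= x < nth 0 (col n) i + w n)%R.

Lemma lev_lt n i x : lev n i x -> (i < H n)%N. Proof. by case. Qed.

Lemma nth_col_grid n i : (i < H n)%N -> exists2 k, (k < H n)%N & nth 0%R (col n) i = (k%:R * w n)%R.
Proof.
move=> iH; have : nth 0%R (col n) i \in col n by rewrite mem_nth ?size_col.
rewrite -(col_perm n).2 => /mapP[k]; rewrite mem_iota => kH ->; by exists k.
Qed.

Lemma lev_uniq n i j x : lev n i x -> lev n j x -> i = j.
Proof.
move=> [iH ix] [jH jx].
have [k _ ke] := nth_col_grid iH; have [l _ le] := nth_col_grid jH.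
have w0 := w_gt0 n.
suff kl : k = l by apply/eqP; rewrite -(nth_uniq 0%R _ _ (col_perm n).1) ?size_col// ke le kl.
move: ix jx; rewrite ke le => /andP[k1 k2] /andP[l1 l2].
have : (k%:R * w n < (l.+1)%:R * w n)%R by rewrite -natr1 mulrDl mul1r; exact: le_lt_trans l2.
have : (l%:R * w n < (k.+1)%:R * w n)%R by rewrite -natr1 mulrDl mul1r; exact: le_lt_trans k2.
rewrite !ltr_pM2r// !ltr_nat; lia.
Qed.

Lemma lev_in n i x : lev n i x -> (0 <= x < E n)%R.
Proof.
move=> [iH]; have [k kH ->] := nth_col_grid iH => /andP[k1 k2].
have w0 := ltW (w_gt0 n).
rewrite (le_trans _ k1) ?mulr_ge0//= E_Hw (lt_le_trans k2)//.
by rewrite -[X in (_ + X)%R]mul1r -mulrDl natr1 ler_wpM2r// ler_nat.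
Qed.

Lemma lev_ex n x : (0 <= x < E n)%R -> exists i, lev n i x.
Proof.
move=> /andP[x0 xE]; have w0 := w_gt0 n.
have xw0 : (0 <= x / w n)%R by rewrite divr_ge0// ltW.
have /andP[k1 k2] := Num.Theory.truncn_itv xw0.
set k := Num.truncn _ in k1 k2.
have kx : (k%:R * w n <= x)%R by rewrite -ler_pdivlMr.
have xk : (x < k%:R * w n + w n)%R by move: k2; rewrite ltr_pdivrMr// -natr1 mulrDl mul1r.
have kH : (k < H n)%N by rewrite -(ltr_nat R) -(ltr_pM2r w0) -E_Hw (le_lt_trans kx).
have /(nthP 0%R)[i] := mem_col_grid kH; rewrite size_col => iH ie.
by exists i; split => //; rewrite ie kx.
Qed.

Lemma lev_child n i x : lev n i x -> exists2 k, (k < 4)%N & lev n.+1 (i + off n k) x.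
Proof.
move=> [iH ix]; have w0 := w_gt0 n.+1.
set y := nth 0%R (col n) i in ix; rewrite wS in ix; move/andP: ix => [yx xy].
have sub k : (k < 4)%N -> (y + k%:R * w n.+1 <= x < y + k%:R * w n.+1 + w n.+1)%R ->
    lev n.+1 (i + off n k) x.
  move=> k4 xk; split; last by rewrite nth_col_child.
  by rewrite (leq_trans _ (off_add_ltH k4 iH))// ltnS leq_addr.
have [x1|x1] := ltP x (y + w n.+1)%R.
  by exists 0%N => //; apply: sub => //; rewrite mul0r addr0 yx.
have [x2|x2] := ltP x (y + 2 * w n.+1)%R.
  by exists 1%N => //; apply: sub => //; rewrite mul1r x1 /=; lra.
have [x3|x3] := ltP x (y + 3 * w n.+1)%R.
  by exists 2%N => //; apply: sub => //; rewrite x2 /=; lra.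
by exists 3%N => //; apply: sub => //; rewrite x3 /=; lra.
Qed.

Lemma lev_parent n i k x : (i < H n)%N -> (k < 4)%N -> lev n.+1 (i + off n k) x -> lev n i x.
Proof.
move=> iH k4 [_]; rewrite nth_col_child// => /andP[x1 x2]; split => //.
have w0 := w_gt0 n.+1.
have k0 : (0 <= k%:R * w n.+1)%R by rewrite mulr_ge0// ltW.
have k3 : (k%:R * w n.+1 <= 3 * w n.+1)%R by rewrite ler_pM2r// ler_nat -ltnS.
by rewrite wS; apply/andP; split; lra.
Qed.

(* [desc n r i j]: level [j] of [G_(n+r)] is contained in level [i] of [G_n]. *)
Fixpoint desc n r (i j : nat) : Prop :=
  match r with
  | 0 => j = i
  | r'.+1 => exists j' k, [/\ desc n r' i j', (k < 4)%N & j = (j' + off (n + r') k)%N]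
  end.

Lemma desc_lt n r i j : (i < H n)%N -> desc n r i j -> (j < H (n + r))%N.
Proof.
move=> iH; elim: r j => [|r IH] j /=; first by rewrite addn0 => ->.
move=> [j' [k [/IH j'H k4 ->]]]; rewrite addnS.
by rewrite (leq_trans _ (off_add_ltH k4 j'H))// ltnS leq_addr.
Qed.

Lemma desc_lt_hh n r i j : (i < H n)%N -> desc n r.+1 i j -> (j < h (n + r).+1)%N.
Proof.
by move=> iH [j' [k [/(desc_lt iH) j'H k4 ->]]]; exact: off_add_lt.
Qed.

Lemma lev_desc n r i x : lev n i x -> exists2 j, desc n r i j & lev (n + r) j x.
Proof.
move=> ix; elim: r => [|r [j ij jx]]; first by exists i => //; rewrite addn0.
have [k k4 kx] := lev_child jx.
by exists (j + off (n + r) k)%N; rewrite ?addnS//; exists j, k.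
Qed.

Lemma desc_lev n r i j x : (i < H n)%N -> desc n r i j -> lev (n + r) j x -> lev n i x.
Proof.
move=> iH; elim: r j => [|r IH] j /=; first by move=> ->; rewrite addn0.
move=> [j' [k [ij k4 ->]]]; rewrite addnS => /lev_parent-/(_ (desc_lt iH ij) k4).
exact: IH.
Qed.

(** [T] selects one of the values proposed by all stages, so these must agree: a value proposed at
    one stage is proposed at all later ones ([SS]), and within one stage the level is unique
    ([Sf]). *)
Lemma lev_next n i x : lev n i x -> (i.+1 < H n)%N ->
  T x = (x + (nth 0 (col n) i.+1 - nth 0 (col n) i))%R.
Proof.
pose S m y := exists j, in_level a b c d m j x /\ y = (x + (nth 0 (col m) j.+1 - nth 0 (col m) j))%R.
have SS m y r : S m y -> S (m + r)%N y.
  move=> Sy; elim: r => [|r [j [[jH jx] ye]]]; first by rewrite addn0.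
  rewrite size_col in jH.
  have jl : lev (m + r) j x by split => //; exact: ltnW.
  have [k k4 [kH kx]] := lev_child jl.
  exists (j + off (m + r) k)%N; split.
    split; last by rewrite addnS.
    rewrite addnS size_col -(addSn j) (leq_trans _ (off_add_ltH k4 jH))// ltnS leq_addr//.
  by rewrite addnS -(addSn j) !nth_col_child ?(ltnW jH)// ye; ring.
have Sf m y y' : S m y -> S m y' -> y = y'.
  move=> [j [[jH jx] ->]] [j' [[jH' jx'] ->]].
  rewrite size_col in jH jH'.
  by rewrite (@lev_uniq m j j' x)//; split => //; exact: ltnW.
move=> [iH ix] i1H; rewrite /Defs.T; case: xgetP =>
  [y _ [m [j mj]]|/(_ (x + (nth 0 (col n) i.+1 - nth 0 (col n) i))%R) []].
  apply: (Sf (m + n)%N); first by apply: SS; exists j.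
  by rewrite addnC; apply: SS; exists i; split => //; split; rewrite ?size_col.
by exists n, i; split => //; split; rewrite ?size_col.
Qed.

Lemma lev_T n i x : lev n i x -> (i.+1 < H n)%N -> lev n i.+1 (T x).
Proof.
move=> ix iH; rewrite (lev_next ix iH); case: ix => _ /andP[x1 x2]; split=> //.
by apply/andP; split; lra.
Qed.

Lemma lev_iter n i s x : lev n i x -> (i + s < H n)%N -> lev n (i + s) (iter s T x).
Proof.
move=> ix; elim: s => [|s IH]; first by rewrite addn0.
by rewrite addnS => sH; apply: lev_T => //; apply: IH; exact: ltnW.
Qed.

Hypothesis d_gt0 : forall n, (0 < d n)%N.

(** Every stage puts at least one spacer on top, so the room above a descendant grows by at least
    one per stage. *)
Lemma desc_room n r i j : (i < H n)%N -> desc n r i j -> (j + r < H (n + r))%N.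
Proof.
move=> iH; elim: r j => [|r IH] j /=; first by move=> ->; rewrite !addn0.
move=> [j' [k [/IH j'H k4 ->]]]; rewrite (addnS n).
have := HS_hh (n + r); have := d_gt0 (n + r).
have : (j' + r + off (n + r) k < h (n + r).+1)%N by exact: off_add_lt.
lia.
Qed.

(** Makes [s] iterates of [T] visible as a climb inside a single column, at every sufficiently late
    stage. *)
Lemma X_lev x s : X x -> exists M, forall r, exists2 i, lev (M + r) i x & (i + s < H (M + r))%N.
Proof.
move=> [n /lev_ex[i ix]]; exists (n + s)%N => r.
have [j ij jx] := lev_desc (s + r) ix.
exists j; rewrite -addnA//.
by have := desc_room (lev_lt ix) ij; lia.
Qed.

Lemma lev_X n i x : lev n i x -> X x.
Proof. by move=> /lev_in xE; exists n. Qed.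

Lemma T_X x : X x -> X (T x).
Proof.
move=> /(X_lev 1)[M /(_ 0%N)[i ix iH]].
by rewrite addn1 in iH; exact: lev_X (lev_T ix iH).
Qed.

Lemma T_notX x : ~ X x -> T x = x.
Proof.
move=> Xx; rewrite /Defs.T; case: xgetP => // y _ [n [j [[jH jx] _]]].
by exfalso; apply: Xx; apply: (@lev_X n j); split => //; rewrite -size_col ltnW.
Qed.

Lemma T_inj : injective T.
Proof.
(* Two points of [X] are compared in the common column of index [M + N]. *)
have key x y : X x -> X y -> T x = T y -> x = y.
  move=> /(X_lev 1)[M xM] /(X_lev 1)[N yN] Txy.
  have [i ix] := xM N; rewrite addn1 => iH.
  have [j jy] := yN M; rewrite (addnC N) addn1 => jH.
  rewrite (addnC N) in jy.
  have := lev_T ix iH; rewrite Txy => /lev_uniq /(_ (lev_T jy jH)) [ij].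
  move: Txy; rewrite (lev_next ix iH) (lev_next jy jH) ij => /addIr; exact.
move=> x y Txy; have [Xx|Xx] := pselect (X x); have [Xy|Xy] := pselect (X y).
- exact: key.
- by case: (Xy); rewrite -(T_notX Xy) -Txy; exact: T_X.
- by case: (Xx); rewrite -(T_notX Xx) Txy; exact: T_X.
- by rewrite -(T_notX Xx) Txy T_notX.
Qed.

Lemma iterT_inj s : injective (iter s T).
Proof. by elim: s => [//|s IH] x y /= /T_inj /IH. Qed.

Lemma lev_shift n i j x : lev n i x -> (j < H n)%N ->
  lev n j (x + (nth 0 (col n) j - nth 0 (col n) i))%R.
Proof. by move=> [iH /andP[x1 x2]] jH; split=> //; apply/andP; split; lra. Qed.

(** The translate [y] of [iter s T x] down to level [i] climbs to [iter s T x] in [s] steps, so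
    injectivity gives [x = y]. *)
Lemma lev_iter_pre n i s x : lev n (i + s) (iter s T x) -> lev n i x.
Proof.
move=> isx; have isH := lev_lt isx.
have iH : (i < H n)%N by lia.
have := lev_shift isx iH; set y := (_ + _)%R => iy.
suff -> : x = y by [].
apply: (@iterT_inj s).
have sE t : (i + t < H n)%N -> iter t T y = (y + (nth 0 (col n) (i + t) - nth 0 (col n) i))%R.
  elim: t => [_|t IH tH]; first by rewrite addn0 /= subrr addr0.
  rewrite iterS (@lev_next n (i + t)%N); last by rewrite -addnS.
    by rewrite IH ?(leq_trans _ tH)// ?addnS//; ring.
  by apply: lev_iter => //; rewrite (leq_trans _ tH)// addnS.
by rewrite sE// /y; ring.
Qed.
End Columns.

(** * Arithmetic rigidity of the number [q i - p j] *)

(** The old indices contribute less than [(p + q) * h] in absolute value, while the offset part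
    [q (o k - o k') - p (o l - o l')] is either zero or at least that large. Indeed [L] dominates
    unless it cancels; what then remains is a combination of [P] and [Q], and the only dangerous
    one, [p Q - q P], is handled by the trichotomy. *)
Lemma offset_rigidity (p q h P L Q i j i' j' k l k' l' : nat) :
  let o k := nth 0 [:: 0; P; P + L; P + L + Q] k in
  0 < p -> p <= q -> P <= Q -> (p + q) * h <= P -> (p + q) * (P + Q + h) <= L ->
  (p * Q = q * P \/ p * Q > q * P + (p + q) * h \/ q * P > p * Q + (p + q) * h) ->
  i < i' + h -> i' < i + h -> j < j' + h -> j' < j + h ->
  k < 4 -> l < 4 -> k' < 4 -> l' < 4 ->
  q * (i + o k) + p * (j' + o l') = q * (i' + o k') + p * (j + o l) ->
  q * i + p * j' = q * i' + p * j.
Proof.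
(* With [q = r + p] and all products taken as atoms, the bounds below make the claim linear. The
   case [r = 0] is separated because [P <= r * P] may fail there. *)
move=> o p0 /subnK <-; set r := q - p.
move=> PQ hP hL D ii i'i jj j'j k4 l4 k'4 l'4.
have pi : p * i < p * i' + p * h by rewrite -mulnDr ltn_pmul2l.
have pi' : p * i' < p * i + p * h by rewrite -mulnDr ltn_pmul2l.
have pj : p * j < p * j' + p * h by rewrite -mulnDr ltn_pmul2l.
have pj' : p * j' < p * j + p * h by rewrite -mulnDr ltn_pmul2l.
have ri : r * i <= r * i' + r * h by rewrite -mulnDr leq_mul // ltnW.
have ri' : r * i' <= r * i + r * h by rewrite -mulnDr leq_mul // ltnW.
have pP : P <= p * P by rewrite leq_pmull.
have pL : L <= p * L by rewrite leq_pmull.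
have pPQ : p * P <= p * Q by rewrite leq_mul.
have rPQ : r * P <= r * Q by rewrite leq_mul.
have r0 : r = 0 \/ P <= r * P /\ L <= r * L.
  by have [->|r0] := posnP r; [left|right; rewrite !leq_pmull].
rewrite ?(mulnDl, mulnDr) in hP hL D *.
have {r0} : (r * P = 0 /\ r * L = 0 /\ r * Q = 0 /\ r * i = 0 /\ r * i' = 0 /\ r * h = 0)
    \/ P <= r * P /\ L <= r * L by case: r0 => [->|]; [left|right].
clear ii i'i jj j'j.
(* All 256 choices of the four subcolumns are checked by linear arithmetic. *)
by move: k l k' l' k4 l4 k'4 l'4
  => [|[|[|[|//]]]] [|[|[|[|//]]]] [|[|[|[|//]]]] [|[|[|[|//]]]] _ _ _ _;
  rewrite /o /= ?mulnDr;
  move: (r * P) (r * L) (r * Q) (r * i) (r * i') (r * h) (p * P) (p * L) (p * Q)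
    (p * i) (p * i') (p * j) (p * j') (p * h)
    hP hL D pi pi' pj pj' ri ri' pP pL pPQ rPQ => *; lia.
Qed.

Lemma finite_set_nat_bounded (A : set nat) : finite_set A ->
  exists N, forall n, (N <= n)%N -> ~ A n.
Proof.
move=> /finite_seqP[s ->]; exists (\max_(i <- s) i).+1 => n sn /= ns.
by have := @leq_bigmax_seq _ s xpredT id n ns isT; rewrite leqNgt sn.
Qed.

Lemma infinite_set_nat_unbounded (A : set nat) : infinite_set A ->
  forall N, exists2 n, (N <= n)%N & A n.
Proof.
move=> infA N; apply: contrapT => noA; apply: infA.
apply: sub_finite_set (finite_II N) => n An /=.
by rewrite ltnNge; apply/negP => Nn; apply: noA; exists n.
Qed.

Section Rigidity.
Variables (a b c d : nat -> nat) (p q : nat).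
Local Notation H := (H a b c d).
Local Notation P := (pp a b c d).
Local Notation L := (ll a b c d).
Local Notation Q := (qq a b c d).
Local Notation h := (hh a b c d).
Local Notation off := (off a b c d).
Local Notation desc := (desc a b c d).

Definition rigid_at n : Prop :=
  [/\ (P n <= Q n)%N, ((p + q) * h n <= P n)%N, ((p + q) * (P n + Q n + h n) <= L n)%N
    & (p * Q n = q * P n \/ p * Q n > q * P n + (p + q) * h n
       \/ q * P n > p * Q n + (p + q) * h n)%N].

Lemma rigid_at_eventually (R : realType) : in_V R a b c d ->
  finite_set [set n : nat | (p * Q n != q * P n)%N /\
    (`|(p * Q n)%N - (q * P n)%N| <= (p + q) * h n)%N] ->
  exists N, forall n, (N <= n)%N -> rigid_at n.
Proof.
move=> [[Ph Lb _] PQ] /finite_set_nat_bounded[N1 fin].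
have [N2 _ N2P] := (cvgryPge _).1 Ph (p + q)%:R%R.
(* Past [N1] the exceptional stages are over, past [N2] the ratio [P / h] is at least [p + q], and
   [n >= p + q] turns the growth of [L] into the required bound. *)
exists (N1 + N2 + (p + q))%N => n Nn; split => //.
- have h0 : (0 < h n)%N by case: (n) => //= k; rewrite /pp; have := H_gt0 a b c d k; lia.
  have /N2P : (N2 <= n)%N by lia.
  by rewrite /= ler_pdivlMr ?ltr0n// -natrM ler_nat.
- have pqn : (p + q <= n)%N by lia.
  by rewrite (leq_trans _ (ltnW (Lb n)))// leq_mul//; lia.
- have /fin nf : (N1 <= n)%N by lia.
  have [?|ne] := eqVneq (p * Q n)%N (q * P n)%N; first by left.
  right; have := contra_not (conj ne) nf.
  by move/negP; rewrite -ltnNge; lia.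
Qed.

Hypotheses (p_gt0 : (0 < p)%N) (pq : (p <= q)%N).

(** Applies [offset_rigidity] from stage [n + r] down to stage [n]. Above stage [n] the indices are
    close automatically, since descendants lie below height [h]; only at stage [n] itself must
    closeness be assumed. *)
Lemma desc_rigid n r e f e' f' i j i' j' :
  (forall m, (n <= m)%N -> rigid_at m) ->
  (e < H n)%N -> (f < H n)%N -> (e' < H n)%N -> (f' < H n)%N ->
  (e < e' + h n)%N -> (e' < e + h n)%N -> (f < f' + h n)%N -> (f' < f + h n)%N ->
  desc n r e i -> desc n r f j -> desc n r e' i' -> desc n r f' j' ->
  (q * i + p * j' = q * i' + p * j)%N -> (q * e + p * f' = q * e' + p * f)%N.
Proof.
move=> rig eH fH e'H f'H ee e'e ff f'f.
elim: r i j i' j' => [|r IH] i j i' j'; first by move=> /= -> -> -> ->.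
move=> [i1 [k [di k4 ->]]] [j1 [l [dj l4 ->]]] [i1' [k' [di' k'4 ->]]] [j1' [l' [dj' l'4 ->]]] eq.
have near u v u1 v1 : (u < H n)%N -> (v < H n)%N -> (u < v + h n)%N ->
    desc n r u u1 -> desc n r v v1 -> (u1 < v1 + h (n + r))%N.
  case: (r) => [|s] uH vH uv; first by rewrite addn0 /= => -> ->.
  by rewrite addnS => /(desc_lt_hh uH) us _; rewrite (leq_trans us)// leq_addl.
have [PQ hP hL D] := rig _ (leq_addr r n).
apply: (IH i1 j1 i1' j1') => //.
by apply: (offset_rigidity (h := h (n + r))) eq => //;
  [exact: near eH e'H ee di di'|exact: near e'H eH e'e di' di
  |exact: near fH f'H ff dj dj'|exact: near f'H fH f'f dj' dj].
Qed.
End Rigidity.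

(** * Invariance of Lebesgue measure under [T] and of the product measure under [S] *)

Section Translation.
Context {R : realType}.
Local Notation mu := (@lebesgue_measure R).

Lemma measurable_addr (t : R) :
  measurable_fun [set: measurableTypeR R] (fun x : R => (x + t)%R : measurableTypeR R).
Proof. exact: measurable_funD. Qed.

Lemma lebesgue_measure_addr (t : R) (A : set R) : measurable A ->
  mu ((fun x : R => (x + t)%R) @^-1` A) = mu A.
Proof.
move=> mA; have mt := measurable_addr t.
rewrite -[LHS]/(pushforward mu ((fun x : R => (x + t)%R) : _ -> measurableTypeR R) A).
apply/esym/lebesgue_measure_unique => //= _ [[x y]] _ <-.
rewrite /pushforward (_ : _ @^-1` _ = `](x - t)%R, (y - t)%R]%classic); last first.
  by apply/seteqP; split => z /=; rewrite !in_itv/= ltrBlDr lerBrDr.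
rewrite !lebesgue_measure_itv/= !lte_fin ltrD2r.
by case: ifP => // _; rewrite -!EFinB; congr EFin; ring.
Qed.
End Translation.

Section MeasurePreserving.
Variables (R : realType) (a b c d : nat -> nat).
Hypothesis d_gt0 : forall n, (0 < d n)%N.
Local Notation H := (H a b c d).
Local Notation w := (Defs.w R).
Local Notation E := (E R a b c d).
Local Notation col := (Defs.col R a b c d).
Local Notation T := (@T R a b c d).
Local Notation X := (@X R a b c d).
Local Notation lev := (@lev R a b c d).
Local Notation mu := (@lebesgue_measure R).

Lemma measurable_lev n i : measurable (lev n i : set (measurableTypeR R)).
Proof.
have [iH|iH] := ltnP i (H n).
  rewrite (_ : lev n i = `[(nth 0 (col n) i)%R, (nth 0 (col n) i + w n)%R[%classic).
    exact: measurable_itv.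
  by apply/seteqP; split=> x /=; rewrite in_itv/=; [case|split].
rewrite (_ : lev n i = set0)//; apply/seteqP; split => x //= [].
by rewrite ltnNge iH.
Qed.

Lemma lebesgue_lev n i : (i < H n)%N -> mu (lev n i) = (w n)%:E.
Proof.
move=> iH; rewrite (_ : lev n i = `[(nth 0 (col n) i)%R, (nth 0 (col n) i + w n)%R[%classic).
  rewrite lebesgue_measure_itv/= lte_fin ltrDl w_gt0 -EFinB; congr EFin; ring.
by apply/seteqP; split=> x /=; rewrite in_itv/=; [case|split].
Qed.

Lemma measurable_X : measurable (X : set (measurableTypeR R)).
Proof.
rewrite (_ : X = \bigcup_n `[0%R, E n[%classic); first exact: bigcupT_measurable.
apply/seteqP; split=> x /=; first by move=> [n xn]; exists n.
by move=> [n _ /=]; rewrite in_itv/= => xn; exists n.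
Qed.

(** Countably many pieces on which [T] is a translation, and a part outside [X] where it is the
    identity; measurability of [T] can be read off. *)
Lemma preimage_T (A : set R) :
  T @^-1` A = (A `\` X) `|` \bigcup_n \bigcup_(i in [set i | (i.+1 < H n)%N])
    (lev n i `&` (fun x => x + (nth 0 (col n) i.+1 - nth 0 (col n) i))%R @^-1` A).
Proof.
apply/seteqP; split => x /=.
  have [Xx Ax|Xx] := pselect (X x); last by rewrite T_notX//; left.
  right; have [M /(_ 0%N)[i ix]] := X_lev d_gt0 1 Xx; rewrite addn1 => iH.
  by exists (M + 0)%N => //; exists i => //; split => //=; rewrite -(lev_next ix).
move=> [[Ax Xx]|[n _ [i /= iH [ix]]]]; first by rewrite T_notX.
by rewrite -(lev_next ix).
Qed.

Lemma measurable_T : measurable_fun [set: measurableTypeR R] (T : _ -> measurableTypeR R).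
Proof.
move=> _ A mA; rewrite setTI preimage_T; apply: measurableU.
  by apply: measurableD => //; exact: measurable_X.
apply: bigcupT_measurable => n; apply: bigcup_measurable => i _.
apply: measurableI; first exact: measurable_lev.
by rewrite -[X in measurable X]setTI; exact: measurable_addr.
Qed.

Lemma nth_col_bottom n : nth 0%R (col n) 0 = 0%R.
Proof.
elim: n => // n IH; rewrite -[X in nth _ _ X]/(0 + off a b c d n 0)%N.
by rewrite nth_col_child ?H_gt0// IH mul0r addr0.
Qed.

(** The bottom levels are the intervals [[0, w n)], which shrink to the point 0. *)
Lemma lev_not_bottom (x : R) : (0 < x)%R -> X x -> exists n i, lev n i.+1 x.
Proof.
move=> x0 [n xn].
have xV0 : (0 < x^-1)%R by rewrite invr_gt0.
have [m wm] : exists m, (w m <= x)%R.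
  exists (Num.truncn x^-1).+1; rewrite /Defs.w -[leRHS]invrK lef_pV2 ?posrE ?invr_gt0 ?ltr0n ?expn_gt0//.
  have /andP[_ /ltW/le_trans] := truncn_itv (ltW xV0).
  apply; rewrite ler_nat; exact/ltnW/ltn_expl.
have [i ix] := lev_ex xn; have [j _ jx] := lev_desc m ix.
exists (n + m)%N; case: j jx => [[_]|j jx]; last by exists j.
rewrite nth_col_bottom add0r => /andP[_ xw]; exfalso.
suff : (w (n + m) <= w m)%R by lra.
by rewrite lef_pV2 ?posrE ?ltr0n ?expn_gt0// ler_nat leq_exp2l// leq_addl.
Qed.

(** [T] translates level [i] onto level [i.+1]; the measures are summed over the levels below the
    top. *)
Lemma lebesgue_T_stage n (B : set R) : measurable B ->
  mu [set x | exists i, [/\ lev n i x, (i.+1 < H n)%N & B (T x)]] =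
  mu [set x | exists i, lev n i.+1 x /\ B x].
Proof.
move=> mB; set m := (H n).-1.
have mH i : (i < m)%N = (i.+1 < H n)%N by rewrite /m; have := H_gt0 a b c d n; lia.
have mTB : measurable (T @^-1` B : set (measurableTypeR R)).
  by rewrite -[X in measurable X]setTI; exact: measurable_T.
have -> : [set x | exists i, [/\ lev n i x, (i.+1 < H n)%N & B (T x)]] =
    \big[setU/set0]_(i < m) (lev n i `&` T @^-1` B).
  rewrite -(bigcup_mkord m (fun i => lev n i `&` T @^-1` B)); apply/seteqP; split=> x /=.
    by move=> [i [ix iH Bx]]; exists i => //=; rewrite mH.
  by move=> [i /=]; rewrite mH => iH [ix Bx]; exists i.
have -> : [set x | exists i, lev n i.+1 x /\ B x] =
    \big[setU/set0]_(i < m) (lev n i.+1 `&` B).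
  rewrite -(bigcup_mkord m (fun i => lev n i.+1 `&` B)); apply/seteqP; split=> x /=.
    by move=> [i [ix Bx]]; exists i => //=; rewrite mH (lev_lt ix).
  by move=> [i /= _ [ix Bx]]; exists i.
rewrite !measure_bigsetU_ord//; last 4 first.
- by move=> i; apply: measurableI => //; exact: measurable_lev.
- apply/trivIsetP => /= i j _ _ ij; apply/seteqP; split => x //= [[ix _] [jx _]].
  by move/eqP: ij; apply; apply/val_inj; case: (lev_uniq ix jx).
- by move=> i; apply: measurableI => //; exact: measurable_lev.
- apply/trivIsetP => /= i j _ _ ij; apply/seteqP; split => x //= [[ix _] [jx _]].
  by move/eqP: ij; apply; apply/val_inj; exact: lev_uniq ix jx.
apply: eq_bigr => i _.
set t := (nth 0 (col n) i.+1 - nth 0 (col n) i)%R.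
rewrite -[RHS](lebesgue_measure_addr t); last first.
  by apply: measurableI => //; exact: measurable_lev.
have iH : (i.+1 < H n)%N by rewrite -mH.
congr (mu _); apply/seteqP; split => x /=.
  by move=> [ix Bx]; rewrite -(lev_next ix iH); split => //; exact: lev_T.
move=> [ix Bx]; have := lev_shift ix (ltnW iH).
rewrite (_ : _ + _ = x)%R; last by rewrite /t; ring.
by move=> {}ix; split => //=; rewrite (lev_next ix iH).
Qed.

(** The equality at each stage passes to the limit by continuity from below. The sets [U n] exhaust
    the preimage of [B] within [X]; the sets [V n] exhaust [B] within [X] except for the point 0,
    which is on the bottom of every column. Outside [X] the map is the identity. *)
Lemma lebesgue_preimage_T (B : set R) : measurable B -> mu (T @^-1` B) = mu B.
Proof.
move=> mB.
have mTB : measurable (T @^-1` B : set (measurableTypeR R)).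
  by rewrite -[X in measurable X]setTI; exact: measurable_T.
pose U n := [set x | exists i, [/\ lev n i x, (i.+1 < H n)%N & B (T x)]].
pose V n := [set x | exists i, lev n i.+1 x /\ B x].
have mU n : measurable (U n : set (measurableTypeR R)).
  rewrite (_ : U n = \bigcup_(i in [set i | (i.+1 < H n)%N]) (lev n i `&` T @^-1` B)).
    by apply: bigcup_measurable => i _; apply: measurableI => //; exact: measurable_lev.
  apply/seteqP; split => x /=; first by move=> [i [ix iH Bx]]; exists i.
  by move=> [i /= iH [ix Bx]]; exists i.
have mV n : measurable (V n : set (measurableTypeR R)).
  rewrite (_ : V n = \bigcup_i (lev n i.+1 `&` B)).
    by apply: bigcupT_measurable => i; apply: measurableI => //; exact: measurable_lev.
  apply/seteqP; split => x /=; first by move=> [i [ix Bx]]; exists i.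
  by move=> [i /= _ [ix Bx]]; exists i.
have ndU : {homo U : n m / (n <= m)%N >-> (n <= m)%O}.
  apply: homo_leq => [A|A B' C|n]; [exact: lexx|exact: le_trans|].
  apply/subsetPset => x [i [ix iH Bx]]; have [k k4 kx] := lev_child ix.
  exists (i + off a b c d n k)%N; split => //.
  by rewrite -addSn (leq_trans _ (off_add_ltH k4 iH))// ltnS leq_addr.
have ndV : {homo V : n m / (n <= m)%N >-> (n <= m)%O}.
  apply: homo_leq => [A|A B' C|n]; [exact: lexx|exact: le_trans|].
  apply/subsetPset => x [i [ix Bx]]; have [k k4 kx] := lev_child ix.
  by exists (i + off a b c d n k)%N; split.
have cU := nondecreasing_cvg_mu (mu := mu) mU (bigcupT_measurable _ mU) ndU.
have cV := nondecreasing_cvg_mu (mu := mu) mV (bigcupT_measurable _ mV) ndV.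
have UV : mu \o U = mu \o V by apply/funext => n; exact: lebesgue_T_stage.
rewrite UV in cU.
have {cU cV UV ndU ndV} UV : mu (\bigcup_n U n) = mu (\bigcup_n V n).
  exact: (cvg_unique (@ereal_hausdorff R) cU cV).
have UE : \bigcup_n U n = T @^-1` B `&` X.
  apply/seteqP; split => x /=; first by move=> [n _ [i [ix iH Bx]]]; split => //; exact: lev_X ix.
  move=> [Bx /(X_lev d_gt0 1)[M /(_ 0%N)[i ix]]]; rewrite addn1 => iH.
  by exists (M + 0)%N => //; exists i.
have VE : \bigcup_n V n = (B `&` X) `\` [set 0%R].
  apply/seteqP; split => x /=.
    move=> [n _ [i [ix Bx]]]; split; first by split => //; exact: lev_X ix.
    move=> x0; suff : lev n 0 x by move=> /(lev_uniq ix).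
    by rewrite x0; split; rewrite ?H_gt0// nth_col_bottom lexx add0r w_gt0.
  move=> [[Bx Xx] /eqP x0]; have [n] := Xx => /andP[xx0 _].
  have xp : (0 < x)%R by rewrite lt_def x0.
  by have [m [i ix]] := lev_not_bottom xp Xx; exists m => //; exists i.
have mBX : measurable (B `&` X : set (measurableTypeR R)) by apply: measurableI => //; exact: measurable_X.
have BX : mu (B `&` X) = mu (T @^-1` B `&` X).
  rewrite -UE UV VE (measureDI mu mBX (measurable_set1 0%R)).
  rewrite [X in (_ + X)%E](_ : _ = 0%E) ?adde0//.
  apply/eqP; rewrite -measure_le0 -(lebesgue_measure_set1 (0%R : R)).
  by apply: le_measure; rewrite ?inE//; apply: measurableI.
have DI (A : set R) : measurable A -> mu A = (mu (A `\` X) + mu (A `&` X))%E.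
  by move=> mA; apply: measureDI => //; exact: measurable_X.
rewrite (DI _ mTB) (DI _ mB) BX; congr (_ + _)%E.
by congr (mu _); apply/seteqP; split => x /= [Bx Xx]; split => //; move: Bx; rewrite T_notX.
Qed.

Lemma measurable_iterT s : measurable_fun [set: measurableTypeR R] (iter s T : _ -> measurableTypeR R).
Proof.
elim: s => [|s IH]; first exact: measurable_id.
exact: (measurableT_comp measurable_T IH).
Qed.

Lemma lebesgue_preimage_iterT s (B : set R) : measurable B -> mu (iter s T @^-1` B) = mu B.
Proof.
move=> mB; elim: s => [//|s IH].
rewrite -IH -[RHS]lebesgue_preimage_T; last first.
  by rewrite -[X in measurable X]setTI; exact: measurable_iterT.
by congr (mu _); apply/seteqP; split=> x /=; rewrite -iterSr.
Qed.

Variables p q : nat.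
Local Notation S := (@prodmap R a b c d p q).
Local Notation mu2 := (mu \x mu)%E.

Lemma measurable_prodmap :
  measurable_fun [set: measurableTypeR R * measurableTypeR R]
    (S : _ -> measurableTypeR R * measurableTypeR R).
Proof.
apply: measurable_fun_pair; apply: measurableT_comp => //; exact: measurable_iterT.
Qed.

Lemma prodmap_preserves (B : set (measurableTypeR R * measurableTypeR R)) :
  measurable B -> mu2 (S @^-1` B) = mu2 B.
Proof.
move=> mB; have mS := measurable_prodmap.
rewrite -[LHS]/(pushforward mu2 (S : _ -> measurableTypeR R * measurableTypeR R) B).
apply/esym/product_measure_unique => //= A1 A2 mA1 mA2.
rewrite /pushforward (_ : S @^-1` _ = (iter p T @^-1` A1) `*` (iter q T @^-1` A2))//.
rewrite product_measure1E//.
- by congr (_ * _)%E; exact: lebesgue_preimage_iterT.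
- by rewrite -[X in measurable X]setTI; exact: measurable_iterT.
- by rewrite -[X in measurable X]setTI; exact: measurable_iterT.
Qed.
End MeasurePreserving.

(** * Recurrence criterion and pigeonhole principle *)

Section Recurrence.
Context (dU : measure_display) (U : measurableType dU) (R : realType).
Variables (mu : {measure set U -> \bar R}%R) (S : U -> U).
Hypothesis mS : measurable_fun [set: U] S.
Hypothesis preserves : forall B, measurable B -> mu (S @^-1` B) = mu B.

Lemma measurable_preimage_iter n B : measurable B -> measurable (iter n S @^-1` B).
Proof.
move=> mB; elim: n => [//|n IH].
rewrite (_ : _ @^-1` _ = S @^-1` (iter n S @^-1` B)).
  by rewrite -[X in measurable X]setTI; exact: mS.
by apply/seteqP; split => x /=; rewrite -iterSr.
Qed.

Lemma preserves_iter n B : measurable B -> mu (iter n S @^-1` B) = mu B.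
Proof.
move=> mB; elim: n => [//|n IH].
rewrite -IH -[RHS]preserves; last exact: measurable_preimage_iter.
by congr (mu _); apply/seteqP; split => x /=; rewrite -iterSr.
Qed.

(* The sets [iter k S @^-1` A] are disjoint for a wandering set [A]; since
   the part of them lying over [C k] stays in the finite-measure set [Q], the
   sum of [mu (A `&` C k)] converges and Borel-Cantelli applies. *)
Lemma recurrence_criterion (Q A : set U) (C : nat -> set U) :
  measurable Q -> (mu Q < +oo)%E -> (forall k, measurable (C k)) ->
  (forall k, iter k S @^-1` C k `<=` Q) -> measurable A ->
  mu.-negligible (A `\` lim_sup_set C) -> (0 < mu A)%E ->
  exists n, (0 < n)%N /\ (0 < mu (iter n S @^-1` A `&` A))%E.
Proof.
move=> mQ Qoo mC CQ mA AC A0; apply: contrapT => wand.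
have null n : (0 < n)%N -> mu (iter n S @^-1` A `&` A) = 0%E.
  move=> n0; apply/eqP; rewrite -measure_le0 leNgt; apply/negP => pos.
  by apply: wand; exists n.
(* [W] collects the points of [A] that return to [A], a null set by assumption. Off [W] the
   preimages are truly disjoint, not only up to null sets. *)
pose W := \bigcup_n (iter n.+1 S @^-1` A `&` A).
have mAn n : measurable (iter n.+1 S @^-1` A `&` A).
  by apply: measurableI => //; exact: measurable_preimage_iter.
have W0 : mu.-negligible W.
  by apply: negligible_bigcup => n; apply/negligibleP => //; exact: null.
pose A1 := A `\` W.
have mA1 : measurable A1 by apply: measurableD => //; exact: bigcupT_measurable.
have mF k : measurable (iter k S @^-1` (A1 `&` C k)).
  by apply: measurable_preimage_iter; exact: measurableI.
have tF : trivIset setT (fun k => iter k S @^-1` (A1 `&` C k)).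
  apply/trivIsetP => /= i j _ _.
  wlog ij : i j / (i < j)%N.
    move=> wl nij; have [ij|ij|ij] := ltngtP i j; first exact: wl.
      by rewrite setIC; apply: wl => //; rewrite eq_sym.
    by rewrite ij eqxx in nij.
  move=> _; apply/seteqP; split => x //= [[[Ai Wi] _] [[Aj _] _]].
  (* The point [iter i S x] would return to [A] after [j - i] steps; the predecessor compensates the
     shift in [W]. *)
  apply: Wi; exists (j - i).-1 => //; split => //=.
  by rewrite -iterS prednK ?subn_gt0// -iterD subnK// ltnW.
have sumF : (\sum_(k <oo) mu (A1 `&` C k) < +oo)%E.
  rewrite (_ : (\sum_(k <oo) _)%E = (\sum_(k <oo) mu (iter k S @^-1` (A1 `&` C k)))%E); last first.
    by apply: eq_eseriesr => k _; rewrite preserves_iter//; exact: measurableI.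
  rewrite -measure_semi_bigcup//; last exact: bigcupT_measurable.
  apply: le_lt_trans Qoo; apply: le_measure; rewrite ?inE//; first exact: bigcupT_measurable.
  by move=> x [k _ [_ Cx]]; exact: CQ Cx.
have mAC k : measurable (A1 `&` C k) by exact: measurableI.
have ls0 := lim_sup_set_cvg0 mAC sumF.
have ml : measurable (lim_sup_set (fun k => A1 `&` C k)).
  by apply: bigcapT_measurable => n; apply: bigcup_measurable => k _.
have : mu.-negligible A.
  apply: (@negligibleS _ _ _ _ ((A `\` lim_sup_set C) `|` W `|` lim_sup_set (fun k => A1 `&` C k))).
    move=> x Ax; have [Cx|Cx] := pselect (lim_sup_set C x); last by left; left.
    have [Wx|Wx] := pselect (W x); first by left; right.
    by right => n _; have [k nk Ck] := Cx n I; exists k.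
  by apply: negligibleU; [exact: negligibleU|apply/negligibleP].
by move/(negligibleP _ mA) => Az; rewrite Az ltxx in A0.
Qed.
End Recurrence.

(** Infinite pigeonhole: if each value [r] were absent from some [g r] on, the value taken at the
    sum of all [g r] would be absent there. *)
Lemma bounded_recurrent_value (p : nat) (f : nat -> nat) : (forall n, (f n < p)%N) ->
  exists rho, forall N, exists2 n, (N <= n)%N & f n = rho.
Proof.
move=> fp; apply: contrapT => /forallNP no.
have {no}/choice[g gP] rho : exists N, forall n, (N <= n)%N -> f n <> rho.
  have /existsNP[N no'] := no rho; exists N => n Nn fn.
  by apply: no'; exists n.
pose M := (\sum_(r < p) g r)%N.
apply: (gP (f M) M) => //.
by rewrite [leqRHS](bigD1 (Ordinal (fp M)))//= leq_addr.
Qed.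

(** * Covers by rectangles of levels and null sets *)

Section Levels2.
Variables (R : realType) (a b c d : nat -> nat).
Local Notation H := (H a b c d).
Local Notation w := (Defs.w R).
Local Notation E := (E R a b c d).
Local Notation X := (@X R a b c d).
Local Notation lev := (@lev R a b c d).
Local Notation off := (off a b c d).
Local Notation mu := (@lebesgue_measure R).
Local Notation mu2 := (mu \x mu)%E.
Local Notation R2 := (measurableTypeR R * measurableTypeR R)%type.

(** Any condition on indices yields a countable union of rectangles; [returns] and [saturation] are
    shaped so that this applies. *)
Lemma measurable_levels (F : nat -> nat -> nat -> Prop) :
  measurable ([set z | exists n i j, [/\ lev n i z.1, lev n j z.2 & F n i j]] : set R2).
Proof.
rewrite (_ : mkset _ = \bigcup_n \bigcup_i \bigcup_(j in [set j | F n i j]) (lev n i `*` lev n j)).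
  do 2!apply: bigcupT_measurable => ?; apply: bigcup_measurable => ? _.
  by apply: measurableX; exact: measurable_lev.
apply/seteqP; split => -[x y] /=.
  by move=> [n [i [j [xi yj Fij]]]]; exists n => //; exists i => //; exists j.
by move=> [n _ [i _ [j /= Fij [xi yj]]]]; exists n, i, j.
Qed.

Definition cover n (s : seq (nat * nat)) : set R2 :=
  [set z | exists2 ij, ij \in s & lev n ij.1 z.1 /\ lev n ij.2 z.2].

Lemma measurable_cover n s : measurable (cover n s).
Proof.
have := measurable_levels (fun m i j => m = n /\ (i, j) \in s).
congr (measurable _); apply/seteqP; split => -[x y] /=.
  by move=> [m [i [j [xi yj [<- ijs]]]]]; exists (i, j).
by move=> [[i j] ijs [xi yj]]; exists n, i, j.
Qed.

Lemma le_lebesgue_lev n i : (mu (lev n i) <= (w n)%:E)%E.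
Proof.
have [iH|iH] := ltnP i (H n); first by rewrite lebesgue_lev.
rewrite (_ : lev n i = set0) ?measure0 ?lee_fin ?ltW ?w_gt0//.
by apply/seteqP; split => x //= [+ _]; rewrite ltnNge iH.
Qed.

Lemma measure_cover n s : (mu2 (cover n s) <= ((size s)%:R * w n ^+ 2)%:E)%E.
Proof.
elim: s => [|[i j] s IH].
  rewrite (_ : cover n [::] = set0) ?measure0 ?mul0r//.
  by apply/seteqP; split => z //= [].
have mij : measurable (lev n i `*` lev n j : set R2).
  by apply: measurableX; exact: measurable_lev.
rewrite (_ : cover n _ = (lev n i `*` lev n j) `|` cover n s); last first.
  apply/seteqP; split => z /=.
    move=> [ij]; rewrite inE => /orP[/eqP -> [? ?]|ijs zz]; [by left|by right; exists ij].
  move=> [[zi zj]|[ij ijs zz]]; first by exists (i, j); rewrite ?mem_head.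
  by exists ij => //; rewrite inE ijs orbT.
apply: (le_trans (measureU2 _ mij (measurable_cover n s))).
rewrite /= -natr1 mulrDl mul1r addrC EFinD leeD//.
rewrite [leLHS]product_measure1E; [|exact: measurable_lev|exact: measurable_lev].
by rewrite expr2 EFinM lee_pmul//; exact: le_lebesgue_lev.
Qed.

Lemma cover_refine (B : set R2) n s (D : seq (nat * nat)) : B `<=` cover n s ->
  (forall z i j k l, B z -> lev n i z.1 -> lev n j z.2 -> (k < 4)%N -> (l < 4)%N ->
    lev n.+1 (i + off n k) z.1 -> lev n.+1 (j + off n l) z.2 -> (k, l) \in D) ->
  exists2 s', size s' = (size s * size D)%N & B `<=` cover n.+1 s'.
Proof.
move=> Bs BD.
exists [seq (ij.1 + off n kl.1, ij.2 + off n kl.2)%N | ij <- s, kl <- D].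
  by rewrite size_allpairs.
move=> z Bz; have [[i j] ijs /= [zi zj]] := Bs _ Bz.
have [k k4 zk] := lev_child zi; have [l l4 zl] := lev_child zj.
exists (i + off n k, j + off n l)%N => //.
apply/allpairsP; exists ((i, j), (k, l)); split => //=.
exact: BD Bz zi zj k4 l4 zk zl.
Qed.

(* Subcolumns are numbered from [0]: [z] lies over the second and the fourth
   subcolumn of [G_n] respectively. *)
Definition digits13 n (z : R * R) : Prop :=
  exists i j, [/\ (i < H n)%N, (j < H n)%N, lev n.+1 (i + off n 1) z.1
                & lev n.+1 (j + off n 3) z.2].

Let all_digits := [seq (k, l) | k <- iota 0 4, l <- iota 0 4].

Lemma cover_step (B : set R2) n s t : B `<=` cover n s ->
  exists2 s', ((size s')%:R * w (n + t) ^+ 2 = (size s)%:R * w n ^+ 2)%R & B `<=` cover (n + t) s'.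
Proof.
move=> Bs; elim: t => [|t [s1 e1 Bs1]]; first by exists s => //; rewrite addn0.
have [|s2 e2 Bs2] := @cover_refine B (n + t) s1 all_digits Bs1.
  move=> z i j k l _ _ _ k4 l4 _ _.
  by apply/allpairsP; exists (k, l); rewrite !mem_iota.
exists s2; rewrite ?addnS//; rewrite -e1 e2 (wS _ (n + t)) natrM (_ : size all_digits = 16)//; ring.
Qed.

(** Of the 16 subrectangles of each rectangle, the one for the excluded pair of subcolumns is
    dropped. *)
Lemma cover_step13 (B : set R2) n s : B `<=` cover n s ->
  (forall z, B z -> ~ digits13 n z) ->
  exists2 s', ((size s')%:R * w n.+1 ^+ 2 = (size s)%:R * w n ^+ 2 * (15 / 16))%R
    & B `<=` cover n.+1 s'.
Proof.
move=> Bs B13.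
have [|s2 e2 Bs2] := @cover_refine B n s (rem (1, 3)%N all_digits) Bs.
  move=> z i j k l Bz zi zj k4 l4 zk zl.
  have kl13 : (k, l) != (1, 3)%N.
    apply/negP => /eqP[k1 l3]; rewrite k1 l3 in zk zl.
    by apply: (B13 _ Bz); exists i, j; split => //; [exact: lev_lt zi|exact: lev_lt zj].
  rewrite rem_filter; last by [].
  rewrite mem_filter /= kl13 /=.
  by apply/allpairsP; exists (k, l); rewrite !mem_iota.
by exists s2 => //; rewrite e2 (wS _ n) natrM (_ : size (rem _ _) = 15); [field|].
Qed.

Definition square N : set R2 := [set z | (0 <= z.1 < E N)%R /\ (0 <= z.2 < E N)%R].

(** Every stage in [G] shrinks the area of a cover by the factor 15/16, and the refinements in
    between keep it. As [G] is unbounded, the areas tend to zero. *)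
Lemma avoid_digits13_negligible N (G : set nat) (B : set R2) : B `<=` square N ->
  (forall m, exists2 n, (m <= n)%N & G n) ->
  (forall n z, (N <= n)%N -> G n -> B z -> ~ digits13 n z) -> mu2.-negligible B.
Proof.
move=> BN Ginf B13.
pose s0 := [seq (i, j) | i <- iota 0 (H N), j <- iota 0 (H N)].
have B0 : B `<=` cover N s0.
  move=> z /BN[/lev_ex[i zi] /lev_ex[j zj]]; exists (i, j) => //.
  apply/allpairsP; exists (i, j); rewrite !mem_iota; split => //=.
    exact: lev_lt zi.
  exact: lev_lt zj.
pose C0 := ((size s0)%:R * w N ^+ 2)%R.
have small m : exists n s, [/\ (N <= n)%N, B `<=` cover n s
    & ((size s)%:R * w n ^+ 2 = C0 * (15 / 16) ^+ m)%R].
  elim: m => [|m [n [s [Nn Bs es]]]]; first by exists N, s0; rewrite expr0 mulr1.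
  have [n' nn' Gn'] := Ginf n.
  have [s1 e1 Bs1] := cover_step (n' - n) Bs; rewrite subnKC// in e1 Bs1.
  have Nn' := leq_trans Nn nn'.
  have [|s2 e2 Bs2] := cover_step13 Bs1; first by move=> z; exact: B13.
  exists n'.+1, s2; split => //; first exact: leqW.
  by rewrite e2 e1 es exprSr -mulrA.
have {small}/choice[Z ZP] m : exists Z : set R2, [/\ measurable Z, B `<=` Z
    & (mu2 Z <= (C0 * (15 / 16) ^+ m)%:E)%E].
  have [n [s [_ Bs es]]] := small m; exists (cover n s); split => //.
    exact: measurable_cover.
  by rewrite -es; exact: measure_cover.
exists (\bigcap_m Z m); split; last by move=> z Bz m _; have [_ + _] := ZP m; apply.
  by apply: bigcapT_measurable => m; have [] := ZP m.
set Y := \bigcap_m Z m.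
have mY : measurable Y by apply: bigcapT_measurable => m; have [] := ZP m.
have Yle m : (mu2 Y <= (C0 * (15 / 16) ^+ m)%:E)%E.
  have [mZ _ /(le_trans _)->//] := ZP m.
  by apply: le_measure; rewrite ?inE// => z /(_ m); exact.
have Yfin : mu2 Y \is a fin_num.
  by rewrite ge0_fin_numE// (le_lt_trans (Yle 0%N))// ltry.
have : (fine (mu2 Y) <= 0)%R.
  have /cvgr_to_ge : geometric C0 (15 / 16)%R @ \oo --> (0%R : R).
    by apply: cvg_geometric; rewrite ger0_norm; lra.
  apply; near=> m; rewrite -lee_fin fineK//; exact: Yle.
by rewrite -lee_fin fineK// measure_le0 => /eqP.
Unshelve. all: by end_near. Qed.
End Levels2.

(** * Conservativity of the product *)

Section ProductDynamics.
Variables (R : realType) (a b c d : nat -> nat) (p q : nat).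
Hypothesis d_gt0 : forall n, (0 < d n)%N.
Hypothesis p_gt0 : (0 < p)%N.
Local Notation H := (H a b c d).
Local Notation P := (pp a b c d).
Local Notation Q := (qq a b c d).
Local Notation h := (hh a b c d).
Local Notation w := (Defs.w R).
Local Notation E := (E R a b c d).
Local Notation T := (@T R a b c d).
Local Notation X := (@X R a b c d).
Local Notation lev := (@lev R a b c d).
Local Notation off := (off a b c d).
Local Notation desc := (desc a b c d).
Local Notation S := (@prodmap R a b c d p q).
Local Notation mu := (@lebesgue_measure R).
Local Notation mu2 := (mu \x mu)%E.
Local Notation R2 := (measurableTypeR R * measurableTypeR R)%type.
Local Notation square := (@square R a b c d).
Local Notation digits13 := (@digits13 R a b c d).

Lemma iter_prodmap k z : iter k S z = (iter (p * k) T z.1, iter (q * k) T z.2).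
Proof.
elim: k => [|k IH]; first by rewrite !muln0; case: z.
by rewrite iterS IH /prodmap /= !mulnS !iterD.
Qed.

(* The part of [S^k (G_N x G_N)] that is visible at the level of indices. *)
Definition returns N k : set R2 :=
  [set z | exists n i j, [/\ lev n i z.1, lev n j z.2
    & exists r e f i' j', [/\ n = (N + r)%N, (e < H N)%N /\ (f < H N)%N,
        desc N r e i' /\ desc N r f j', i = (i' + p * k)%N & j = (j' + q * k)%N]]].

(** If the [k]-th image is at the levels [i' + p k] and [j' + q k], the point itself is at [i'] and
    [j'], which descend from levels of [G_N]. *)
Lemma returns_square N k : iter k S @^-1` returns N k `<=` square N.
Proof.
move=> [x y] /= [n [i [j]]]; rewrite iter_prodmap /=.
move=> [xi yj [r [e [f [i' [j' [nE [eH fH] [di dj] iE jE]]]]]]].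
rewrite {}nE {}iE {}jE in xi yj.
by split; apply: lev_in; [apply: desc_lev di _|apply: desc_lev dj _] => //;
  apply: lev_iter_pre; eassumption.
Qed.

Lemma returns_infinitely_often N z : square N z ->
  (forall m, exists2 n, (m <= n)%N & (p * Q n = q * P n)%N /\ digits13 n z) ->
  lim_sup_set (returns N) z.
Proof.
case: z => x y [/lev_ex[e xe] /lev_ex[f yf]] inf.
pose sel s : bool := `[< (p * Q (N + s) = q * P (N + s))%N /\ digits13 (N + s) (x, y) >].
(* Total amounts by which the two coordinates are lowered at the selected stages between [r0] and
   [r]. *)
pose sP r0 r := (\sum_(r0 <= s < r) sel s * P (N + s))%N.
pose sQ r0 r := (\sum_(r0 <= s < r) sel s * Q (N + s))%N.
have pQP r0 r : (p * sQ r0 r = q * sP r0 r)%N.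
  rewrite /sP /sQ !big_distrr /=; apply: eq_bigr => s _.
  case: (asboolP _ : reflect _ (sel s)) => [[e1 _]|_]; last by rewrite !mul0n !muln0.
  by rewrite !mul1n.
(* The indices [i] and [j] follow the subcolumns of the point, except that from stage [N + r0] on
   the selected stages use the first and third subcolumns instead of the second and fourth. *)
have path r0 t : exists i j, [/\ desc N (r0 + t) e i, desc N (r0 + t) f j,
    lev (N + (r0 + t)) (i + sP r0 (r0 + t)) x & lev (N + (r0 + t)) (j + sQ r0 (r0 + t)) y]%N.
  elim: t => [|t [i [j [di dj xi yj]]]].
    have [i di xi] := lev_desc r0 xe; have [j dj yj] := lev_desc r0 yf.
    by exists i, j; rewrite addn0 /sP /sQ !big_geq// !addn0.
  rewrite !addnS /sP /sQ !big_nat_recr ?leq_addr//= -/(sP _ _) -/(sQ _ _).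
  case: (asboolP _ : reflect _ (sel (r0 + t)%N)) => [[_ [i1 [j1 [i1H j1H /= xi1 yj1]]]]|_].
    have := lev_uniq (lev_parent i1H _ xi1) xi => /(_ isT) i1E.
    have := lev_uniq (lev_parent j1H _ yj1) yj => /(_ isT) j1E.
    rewrite i1E j1E in xi1 yj1.
    exists i, (j + off (N + (r0 + t)) 2)%N; split.
    - by exists i, 0%N; split => //; exact/esym/addn0.
    - by exists j, 2%N.
    - by move: xi1; rewrite mul1n (addnA i).
    - suff -> : (j + off (N + (r0 + t)) 2 + (sQ r0 (r0 + t) + 1 * Q (N + (r0 + t)))
        = j + sQ r0 (r0 + t) + off (N + (r0 + t)) 3)%N by [].
      by rewrite /off /=; lia.
  have [k k4 xk] := lev_child xi; have [l l4 yl] := lev_child yj.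
  exists (i + off (N + (r0 + t)) k)%N, (j + off (N + (r0 + t)) l)%N.
  rewrite !mul0n !addn0; split; [by exists i, k|by exists j, l| |].
    by rewrite addnAC.
  by rewrite addnAC.
have sPmono r0 r r' : (r <= r')%N -> (sP r0 r <= sP r0 r')%N.
  move=> rr'; have [r0r|rr0] := leqP r0 r; last by rewrite /sP big_geq// ltnW.
  by rewrite /sP (big_cat_nat r0r rr') leq_addr.
have sPub r0 B : exists r, (B <= sP r0 r)%N.
  elim: B => [|B [r Br]]; first by exists 0%N.
  have [n nr [good dig]] := inf (N + (r + r0))%N.
  have Nn : (N + (n - N) = n)%N by lia.
  exists (n - N).+1; rewrite /sP big_nat_recr; last by lia.
  have -> : sel (n - N)%N by apply/asboolP; rewrite Nn.
  rewrite /= mul1n Nn -addn1 leq_add//; first by rewrite (leq_trans Br)// sPmono//; lia.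
  by rewrite /pp; have := H_gt0 a b c d n; lia.
(* Two partial sums with equal residue mod [p] differ by a multiple [p k]; then [p sQ = q sP] gives
   [sQ = q k]. Taking the later one far enough makes [k] at least [k0]. *)
have [rho rhoP] := @bounded_recurrent_value p (fun r => sP 0%N r %% p)%N (fun r => ltn_pmod _ p_gt0).
have [r0 _ r0P] := rhoP 0%N.
move=> k0 _; have [r Br] := sPub r0 (p * k0)%N.
have [r1 r1r r1P] := rhoP (r + r0)%N.
have r01 : (r0 <= r1)%N by lia.
have /dvdnP[k kP] : (p %| sP r0 r1)%N.
  have : (sP 0 r1 = sP 0 r0 + sP r0 r1)%N by rewrite /sP (big_cat_nat (leq0n r0) r01).
  move=> sE; have : (sP 0%N r0 + sP r0 r1 == sP 0%N r0 + 0 %[mod p])%N.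
    by rewrite -sE addn0 r1P r0P.
  by rewrite eqn_modDl mod0n.
have kQ : sQ r0 r1 = (q * k)%N.
  by apply/eqP; rewrite -(eqn_pmul2l p_gt0) pQP kP; apply/eqP; lia.
have kk0 : (k0 <= k)%N.
  rewrite -(leq_pmul2l p_gt0) (leq_trans Br)// mulnC -kP sPmono//; lia.
exists k => //; have [i [j [di dj xi yj]]] := path r0 (r1 - r0)%N.
rewrite subnKC// in di dj xi yj.
exists (N + r1)%N, (i + p * k)%N, (j + q * k)%N; split.
- by rewrite mulnC -kP.
- by rewrite -kQ.
- exists r1, e, f, i, j; split => //; split; [exact: lev_lt xe|exact: lev_lt yf].
Qed.

Lemma E_mono m n : (m <= n)%N -> (E m <= E n)%R.
Proof.
apply: (homo_leq (@lexx _ R) (@le_trans _ R)) => k /=.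
by rewrite lerDl mulr_ge0// ltW// w_gt0.
Qed.

Lemma measurable_square N : measurable (square N).
Proof.
rewrite (_ : square N = `[0%R, E N[%classic `*` `[0%R, E N[%classic); first exact: measurableX.
by apply/seteqP; split => z /=; rewrite !in_itv.
Qed.

Lemma measure_square N : (mu2 (square N) < +oo)%E.
Proof.
rewrite (_ : square N = `[0%R, E N[%classic `*` `[0%R, E N[%classic); last first.
  by apply/seteqP; split => z /=; rewrite !in_itv.
rewrite product_measure1E//.
rewrite [X in (X * _)%E]lebesgue_measure_itv [X in (_ * X)%E]lebesgue_measure_itv/=.
by case: ifP => _; rewrite ?mul0e// -EFinB -EFinM ltry.
Qed.

Lemma prodmap_conservative : (forall m, exists2 n, (m <= n)%N & (p * Q n = q * P n)%N) ->
  conservative_on mu2 (X `*` X) S.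
Proof.
move=> good A mA AX A0.
(* The squares exhaust [X * X], so one of them meets [A] in positive measure. *)
have [N AN] : exists N, (0 < mu2 (A `&` square N))%E.
  apply: contrapT => /forallNP no.
  have : mu2.-negligible A.
    apply: (@negligibleS _ _ _ _ (\bigcup_N (A `&` square N))).
      move=> z Az; have [[m zm] [n zn]] := AX _ Az.
      exists (m + n)%N => //; split => //.
      have Em := E_mono (leq_addr n m); have En := E_mono (leq_addl m n).
      move/andP: zm => [? ?]; move/andP: zn => [? ?].
      by split; apply/andP; split; lra.
    apply: negligible_bigcup => N; apply/negligibleP.
      by apply: measurableI => //; exact: measurable_square.
    by apply/eqP; rewrite -measure_le0 leNgt; apply/negP; exact: no.
  by move/(negligibleP _ mA) => Az; rewrite Az ltxx in A0.
have mN := measurable_square N.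
have mS := @measurable_prodmap R a b c d d_gt0 p q.
have pS := @prodmap_preserves R a b c d d_gt0 p q.
have mAN : measurable (A `&` square N) by exact: measurableI.
have mC k : measurable (returns N k) by exact: measurable_levels.
have [|n [n0 pos]] := recurrence_criterion mS pS mN (measure_square N) mC
    (@returns_square N) mAN _ AN.
  (* A point that is not in infinitely many [returns N k] shows the digits at no good stage past
     some [N + m]; for each [m] such points form a null set. *)
  apply: (@negligibleS _ _ _ _ (\bigcup_m [set z | square N z /\
      forall n, (N + m <= n)%N -> (p * Q n = q * P n)%N -> ~ digits13 n z])).
    move=> z [[Az Nz] nls]; apply: contrapT => nB; apply: nls.
    apply: returns_infinitely_often => // m; apply: contrapT => nG.
    apply: nB; exists m => //; split => // n mn gn dn.
    by apply: nG; exists n => //; lia.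
  apply: negligible_bigcup => m.
  apply: (@avoid_digits13_negligible R a b c d N [set n | (N + m <= n)%N /\ (p * Q n = q * P n)%N]).
  - by move=> z [].
  - by move=> k; have [n kn gn] := good (N + m + k)%N; exists n; [lia|split => //; lia].
  - by move=> n z _ [mn gn] [_]; apply.
exists n; split => //; apply: lt_le_trans pos _; apply: le_measure; rewrite ?inE.
- by apply: measurableI => //; exact: (measurable_preimage_iter mS).
- by apply: measurableI => //; exact: (measurable_preimage_iter mS).
- by move=> z [[? _] [? _]]; split.
Qed.

(** * Orbit of a rectangle and failure of ergodicity *)

(* The orbit of the bottom rectangle of [G_n0 x G_n0], written with level indices:
   in this form its measurability is immediate. *)
Definition saturation n0 : set R2 :=
  [set z | exists n i j, [/\ lev n i z.1, lev n j z.2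
    & exists r i' j' s t, [/\ n = (n0 + r)%N, desc n0 r 0 i', desc n0 r 0 j',
        (i + p * s = i' + p * t)%N & (j + q * s = j' + q * t)%N]]].

(** Adding the same offsets to [(i, j)] and [(i', j')] keeps their difference, so a witness can be
    moved to any later stage. *)
Lemma saturation_later n0 z m : saturation n0 z -> exists n, (m <= n)%N /\
  exists i j, [/\ lev n i z.1, lev n j z.2
    & exists r i' j' s t, [/\ n = (n0 + r)%N, desc n0 r 0 i', desc n0 r 0 j',
        (i + p * s = i' + p * t)%N & (j + q * s = j' + q * t)%N]].
Proof.
move=> Az; elim: m => [|m [n [mn Bz]]].
  by move: Az => [n [i [j Az]]]; exists n; split => //; exists i, j.
have [nm|nm] := ltnP m n; first by exists n; split => //.
move: Bz => [i [j [zi zj [r [i' [j' [s [t [nE di dj ei ej]]]]]]]]].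
have [k k4 zk] := lev_child zi; have [l l4 zl] := lev_child zj.
exists n.+1; split => //; exists (i + off n k)%N, (j + off n l)%N; split => //.
exists r.+1, (i' + off n k)%N, (j' + off n l)%N, s, t; split.
- by rewrite nE addnS.
- by exists i', k; rewrite nE.
- by exists j', l; rewrite nE.
- lia.
- lia.
Qed.

Lemma saturation_X n0 : saturation n0 `<=` X `*` X.
Proof. by move=> z [n [i [j [zi zj _]]]]; split; [exact: lev_X zi|exact: lev_X zj]. Qed.

(** [t - s] is the signed number of steps from a descendant of the rectangle. It is raised by [t.+1]
    on passing to the image and lowered by [s.+1] on passing back, at a stage late enough to have
    [p] and [q] levels above the point. *)
Lemma saturation_invariant n0 : (X `*` X) `&` S @^-1` saturation n0 = saturation n0.
Proof.
apply/seteqP; split => [z [[Xx Xy] Sz]|z Az].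
  have [M1 x1] := X_lev d_gt0 p Xx; have [M2 y2] := X_lev d_gt0 q Xy.
  have [n [Mn [i1 [j1 [zi1 zj1 [r [i' [j' [s [t [nE di dj ei ej]]]]]]]]]]] :=
    saturation_later (M1 + M2) Sz.
  have [i zi iH] := x1 (n - M1)%N; have [j zj jH] := y2 (n - M2)%N.
  rewrite subnKC in zi iH; last lia.
  rewrite subnKC in zj jH; last lia.
  have i1E := lev_uniq (lev_iter zi iH) zi1; have j1E := lev_uniq (lev_iter zj jH) zj1.
  exists n, i, j; split => //; exists r, i', j', s.+1, t; split => //; rewrite mulnS; lia.
have [Xx Xy] := saturation_X Az; split => //.
have [M1 x1] := X_lev d_gt0 p Xx; have [M2 y2] := X_lev d_gt0 q Xy.
have [n [Mn [i1 [j1 [zi1 zj1 [r [i' [j' [s [t [nE di dj ei ej]]]]]]]]]]] :=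
  saturation_later (M1 + M2) Az.
have [i zi iH] := x1 (n - M1)%N; have [j zj jH] := y2 (n - M2)%N.
rewrite subnKC in zi iH; last lia.
rewrite subnKC in zj jH; last lia.
have i1E := lev_uniq zi zi1; have j1E := lev_uniq zj zj1.
exists n, (i + p)%N, (j + q)%N; split; [exact: lev_iter|exact: lev_iter|].
by exists r, i', j', s, t.+1; split => //; rewrite mulnS; lia.
Qed.

(** A common point would give descendants of [(1, 0)] and [(0, 0)] with the same number [q i - p j].
    By [desc_rigid] the numbers of [(1, 0)] and [(0, 0)] would agree, that is [q = 0]. *)
Lemma saturation_rigid n0 : (p <= q)%N -> (0 < n0)%N ->
  (forall m, (n0 <= m)%N -> rigid_at a b c d p q m) ->
  saturation n0 `&` (lev n0 1 `*` lev n0 0) = set0.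
Proof.
move=> pq n0_gt0 rig; apply/seteqP; split => z //= [[n [i [j [zi zj]]]]].
move=> [r [i' [j' [s [t [nE di' dj' ei ej]]]]]] [z1 z0]; rewrite {}nE in zi zj.
have [i2 di zi2] := lev_desc r z1; have [j2 dj zj2] := lev_desc r z0.
have iE := lev_uniq zi2 zi; have jE := lev_uniq zj2 zj; subst i2 j2.
(* Makes the indices 0 and 1 close at stage [n0]; at stage 0 it fails, as [h 0 = 1]. *)
have h1 : (1 < h n0)%N.
  by case: (n0) n0_gt0 => //= m _; rewrite /pp /ll; have := H_gt0 a b c d m; lia.
have H1 := lev_lt z1; have H0 := lev_lt z0.
have eq : (q * i + p * j' = q * i' + p * j)%N.
  have e1 : (q * (i + p * s) = q * (i' + p * t))%N by rewrite ei.
  have e2 : (p * (j + q * s) = p * (j' + q * t))%N by rewrite ej.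
  move: e1 e2; rewrite !mulnDr !(mulnCA q p); lia.
have := desc_rigid p_gt0 pq rig H1 H0 H0 H0 _ _ _ _ di dj di' dj' eq.
rewrite !muln0 !add0n => /(_ h1 isT (ltnW h1) (ltnW h1)).
lia.
Qed.
End ProductDynamics.

(** * Rectangles of positive measure and the conclusion *)

Lemma measure_lev_rectangle (R : realType) (a b c d : nat -> nat) n i j :
  (i < H a b c d n)%N -> (j < H a b c d n)%N ->
  (0 < ((@lebesgue_measure R) \x (@lebesgue_measure R))
    (@lev R a b c d n i `*` @lev R a b c d n j))%E.
Proof.
move=> iH jH; rewrite product_measure1E; [|exact: measurable_lev|exact: measurable_lev].
by rewrite [X in (X * _)%E]lebesgue_lev// [X in (_ * X)%E]lebesgue_lev// -EFinM lte_fin mulr_gt0// w_gt0.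
Qed.

Theorem mainTheorem4 (R : realType) (a b c d : nat -> nat) (p q : nat) :
  (forall n, 0 < a n /\ 0 < b n /\ 0 < c n /\ 0 < d n)%N ->
  in_V R a b c d ->
  infinite_set [set n : nat | (p * qq a b c d n = q * pp a b c d n)%N] ->
  finite_set [set n : nat | (p * qq a b c d n != q * pp a b c d n)%N /\
                            (`|(p * qq a b c d n)%N - (q * pp a b c d n)%N| <= (p + q) * hh a b c d n)%N] ->
  conservative_on ((@lebesgue_measure R) \x (@lebesgue_measure R))%E
    (X a b c d `*` X a b c d) (prodmap a b c d p q)
  /\ ~ ergodic_on ((@lebesgue_measure R) \x (@lebesgue_measure R))%E
    (X a b c d `*` X a b c d) (prodmap a b c d p q).
Proof.
move=> abcd_gt0 vV /infinite_set_nat_unbounded good fin.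
have d_gt0 n : (0 < d n)%N by have [_ [_ []]] := abcd_gt0 n.
set mu2 := ((@lebesgue_measure R) \x (@lebesgue_measure R))%E.
set Y := X a b c d `*` X a b c d; set S := prodmap a b c d p q.
have mY : measurable (Y : set (measurableTypeR R * measurableTypeR R)).
  by apply: measurableX; exact: measurable_X.
(* An invariant set that contains one rectangle of positive measure and misses another is neither
   null nor conull. *)
have nonergodic (A : set (measurableTypeR R * measurableTypeR R)) n0 : (0 < n0)%N ->
    measurable A -> A `<=` Y -> Y `&` S @^-1` A = A ->
    @lev R a b c d n0 0 `*` @lev R a b c d n0 0 `<=` A ->
    A `&` (@lev R a b c d n0 1 `*` @lev R a b c d n0 0) = set0 ->
    ~ ergodic_on mu2 Y S.
  move=> n0_gt0 mA AY AS A0 A1 /(_ A mA AY AS).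
  have H1 : (1 < H a b c d n0)%N.
    by case: n0 n0_gt0 {A0 A1} => //= m _; have := H_gt0 a b c d m; lia.
  have H0 := ltnW H1.
  have mlev i j : measurable (@lev R a b c d n0 i `*` @lev R a b c d n0 j
      : set (measurableTypeR R * measurableTypeR R)).
    by apply: measurableX; exact: measurable_lev.
  have mYA := measurableD mY mA.
  case=> [muA|muYA].
    have := measure_lev_rectangle R H0 H0; rewrite ltNge -[X in (_ <= X)%E]muA.
    by rewrite le_measure// inE.
  have := measure_lev_rectangle R H1 H0; rewrite ltNge -[X in (_ <= X)%E]muYA.
  rewrite le_measure// ?inE// => z zl; split.
    by case: zl => z1 z0; split; [exact: lev_X z1|exact: lev_X z0].
  by move=> Az; have : set0 z by rewrite -A1.
have Hpos n : (0 < pp a b c d n)%N /\ (0 < qq a b c d n)%N.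
  by rewrite /pp /qq; have := H_gt0 a b c d n; lia.
(* For [p = 0], a stage with [p Q = q P] and [P > 0] forces [q = 0]. Then the product is the
   identity, and a single rectangle is already invariant. *)
have [p0|p_gt0] := posnP p.
  have q0 : q = 0%N.
    have [n _] := good 0%N; rewrite p0 /=; have [P0 _] := Hpos n.
    by move=> /esym/eqP; rewrite mul0n muln_eq0 (gtn_eqF P0) orbF => /eqP.
  have SE : S = id by apply/funext => -[x y]; rewrite /S p0 q0.
  split.
    move=> A mA AY A0; exists 1%N; split => //.
    by rewrite SE /= preimage_id setIid.
  apply: (nonergodic (@lev R a b c d 1 0 `*` @lev R a b c d 1 0) 1%N) => //.
  - by apply: measurableX; exact: measurable_lev.
  - by move=> z [z1 z0]; split; [exact: lev_X z1|exact: lev_X z0].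
  - rewrite SE preimage_id; apply: setIidr => z [z1 z0].
    by split; [exact: lev_X z1|exact: lev_X z0].
  - by apply/seteqP; split => z //= [[z1 _] [z0 _]]; have := lev_uniq z1 z0.
split; first exact: prodmap_conservative.
(* At any good stage [p P <= p Q = q P], and [P] is positive. *)
have pq : (p <= q)%N.
  have [n _ /= e] := good 0%N; have [P0 _] := Hpos n; have [_ PQ] := vV.
  by rewrite -(leq_pmul2r P0) -e leq_mul.
have [N rig] := rigid_at_eventually vV fin.
apply: (nonergodic (@saturation R a b c d p q N.+1) N.+1) => //.
- exact: measurable_levels.
- exact: saturation_X.
- exact: saturation_invariant.
(* The rectangle lies in its own orbit, with no refinement and no steps: [r = s = t = 0]. *)
- move=> z [z1 z0]; exists N.+1, 0%N, 0%N; split => //.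
  by exists 0%N, 0%N, 0%N, 0%N, 0%N; rewrite addn0.
- by apply: saturation_rigid => // m /ltnW; exact: rig.
Qed.
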